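(* Let $\mathbf{A}\in\mathbb{Q}^{m\times n}$, let $r\le s\le l\le\min\{m,n\}$, let $\boldsymbol{\Omega}\in\mathbb{Q}^{n\times s}$ and $\boldsymbol{\Psi}\in\mathbb{Q}^{l\times m}$, and put $\mathbf{Y}=\mathbf{A}\boldsymbol{\Omega}$, $\mathbf{W}=\boldsymbol{\Psi}\mathbf{A}$. Let $\mathbf{H}\in\mathbb{Q}^{m\times s}$ satisfy $\mathcal{R}(\mathbf{H})=\mathcal{R}(\mathbf{Y})$ and have full column rank, and let $\mathbf{X}=(\boldsymbol{\Psi}\mathbf{H})^\dagger\mathbf{W}\in\mathbb{Q}^{s\times n}$. Let $\mathbf{Q},\mathbf{Q}_\bot,\boldsymbol{\Psi}_1,\boldsymbol{\Psi}_2,\boldsymbol{\Omega}_1,\boldsymbol{\Omega}_2,\Sigma_2$ be as defined in the context. If $\boldsymbol{\Omega}_1^*$ and $\boldsymbol{\Psi}_2$ have full column rank, then $$\|\mathbf{A}-\mathbf{H}\mathbf{X}\|_F^2=\|\mathbf{A}-\mathbf{Q}\mathbf{Q}^*\mathbf{A}\|_F^2+\|\boldsymbol{\Psi}_2^\dagger\boldsymbol{\Psi}_1(\mathbf{Q}_\bot^*\mathbf{A})\|_F^2\le\left(1+\|\boldsymbol{\Psi}_2^\dagger\boldsymbol{\Psi}_1\|_2^2\right)\left(1+\|\boldsymbol{\Omega}_2\boldsymbol{\Omega}_1^\dagger\|_2^2\right)\|\Sigma_2\|_F^2 .$$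
   Context: $\mathbb{Q}$ denotes the real quaternions; for a quaternion matrix, $^*$ is the conjugate transpose, $\mathcal{R}(\cdot)$ is the right linear span of the columns, $\|\cdot\|_F$ is the Frobenius norm, $\|\cdot\|_2$ is the spectral norm (largest singular value), and $^\dagger$ is the Moore-Penrose inverse (unique solution of the four Penrose equations). Write $\mathbf{H}=\mathbf{Q}\mathbf{B}$ with $\mathbf{Q}\in\mathbb{Q}^{m\times s}$, $\mathbf{Q}^*\mathbf{Q}=I_s$ and $\mathbf{B}\in\mathbb{Q}^{s\times s}$ invertible (e.g. a thin QR, compact SVD or polar decomposition). Let $\mathbf{Q}_\bot\in\mathbb{Q}^{m\times(m-s)}$ have orthonormal columns with $\mathbf{Q}_\bot\mathbf{Q}_\bot^*=I_m-\mathbf{Q}\mathbf{Q}^*$. Set $\boldsymbol{\Psi}_1=\boldsymbol{\Psi}\mathbf{Q}_\bot\in\mathbb{Q}^{l\times(m-s)}$ and $\boldsymbol{\Psi}_2=\boldsymbol{\Psi}\mathbf{Q}\in\mathbb{Q}^{l\times s}$. Let $\mathbf{A}=\mathbf{U}\Sigma\mathbf{V}^*=[\mathbf{U}_1,\mathbf{U}_2]\begin{bmatrix}\Sigma_1&0\\0&\Sigma_2\end{bmatrix}\begin{bmatrix}\mathbf{V}_1^*\\ \mathbf{V}_2^*\end{bmatrix}$ be a quaternion singular value decomposition (unitary factors $\mathbf{U},\mathbf{V}$, real nonnegative diagonal $\Sigma$ with nonincreasing diagonal), where $\Sigma_1\in\mathbb{R}^{r\times r}$ contains the $r$ largest singular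 values, $\mathbf{U}_1\in\mathbb{Q}^{m\times r}$, $\mathbf{V}_1\in\mathbb{Q}^{n\times r}$, $\mathbf{V}_2\in\mathbb{Q}^{n\times(n-r)}$. Set $\boldsymbol{\Omega}_1=\mathbf{V}_1^*\boldsymbol{\Omega}\in\mathbb{Q}^{r\times s}$ and $\boldsymbol{\Omega}_2=\mathbf{V}_2^*\boldsymbol{\Omega}\in\mathbb{Q}^{(n-r)\times s}$. *)

(* Defs.v *)
From HB Require Import structures.
From mathcomp Require Import all_boot all_order all_algebra.
From mathcomp Require Import boolp classical_sets reals ring.

Set Implicit Arguments.
Unset Strict Implicit.
Unset Printing Implicit Defensive.

Import Order.TTheory GRing.Theory Num.Theory.
Local Open Scope ring_scope.

Record quaternion (R : Type) := Quat { qre : R; qim : R; qjm : R; qkm : R }.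

Section QuaternionRing.
Variable R : comNzRingType.
Local Notation H := (quaternion R).
Implicit Types p q : H.

Definition quat_tuple q := (qre q, qim q, qjm q, qkm q).
Definition tuple_quat (t : R * R * R * R) : H :=
  let: (a, b, c, d) := t in Quat a b c d.

Lemma quat_tupleK : cancel quat_tuple tuple_quat.
Proof. by case. Qed.

HB.instance Definition _ := Choice.copy H (can_type quat_tupleK).

Definition addq p q : H :=
  Quat (qre p + qre q) (qim p + qim q) (qjm p + qjm q) (qkm p + qkm q).

Definition oppq q : H := Quat (- qre q) (- qim q) (- qjm q) (- qkm q).

(* i^2 = j^2 = k^2 = ijk = -1 *)
Definition mulq p q : H :=
  Quat
    (qre p * qre q - qim p * qim q - qjm p * qjm q - qkm p * qkm q)
    (qre p * qim q + qim p * qre q + qjm p * qkm q - qkm p * qjm q)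
    (qre p * qjm q - qim p * qkm q + qjm p * qre q + qkm p * qim q)
    (qre p * qkm q + qim p * qjm q - qjm p * qim q + qkm p * qre q).

Definition realq (a : R) : H := Quat a 0 0 0.

Fact addqA : associative addq.
Proof. by move=> p q r; congr Quat; rewrite /= addrA. Qed.

Fact addqC : commutative addq.
Proof. by move=> p q; congr Quat; rewrite addrC. Qed.

Fact add0q : left_id (realq 0) addq.
Proof. by case=> a b c d; congr Quat; rewrite /= add0r. Qed.

Fact addNq : left_inverse (realq 0) oppq addq.
Proof. by case=> a b c d; congr Quat; rewrite /= addNr. Qed.

HB.instance Definition _ := GRing.isZmodule.Build H addqA addqC add0q addNq.

Fact mulqA : associative mulq.
Proof. by move=> p q r; congr Quat => /=; ring. Qed.

Fact mul1q : left_id (realq 1) mulq.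
Proof. by case=> a b c d; congr Quat => /=; ring. Qed.

Fact mulq1 : right_id (realq 1) mulq.
Proof. by case=> a b c d; congr Quat => /=; ring. Qed.

Fact mulqDl : left_distributive mulq addq.
Proof. by move=> p q r; congr Quat => /=; ring. Qed.

Fact mulqDr : right_distributive mulq addq.
Proof. by move=> p q r; congr Quat => /=; ring. Qed.

Fact oneq_neq0 : realq 1 != 0.
Proof. by apply/eqP; case=> /eqP; rewrite oner_eq0. Qed.

HB.instance Definition _ := GRing.Zmodule_isNzRing.Build H
  mulqA mul1q mulq1 mulqDl mulqDr oneq_neq0.

Definition conjq q : H := Quat (qre q) (- qim q) (- qjm q) (- qkm q).

Definition normq2 q : R := qre q ^+ 2 + qim q ^+ 2 + qjm q ^+ 2 + qkm q ^+ 2.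

End QuaternionRing.

Section QuaternionMatrix.
Variable R : realType.
Local Notation H := (quaternion R).

Definition qreal_mx m n (S : 'M[R]_(m, n)) : 'M[H]_(m, n) :=
  map_mx (@realq R) S.

Definition adjq m n (M : 'M[H]_(m, n)) : 'M[H]_(n, m) :=
  (map_mx (@conjq R) M)^T.

(* mulmx puts the entries of x on the right, so M *m x is a right linear
   combination of the columns of M. *)
Definition qrange m n (M : 'M[H]_(m, n)) : set 'cV[H]_m :=
  range (fun x : 'cV[H]_n => M *m x).

Definition full_col_rank m n (M : 'M[H]_(m, n)) : Prop :=
  forall x : 'cV[H]_n, M *m x = 0 -> x = 0.

(* unitmx is only available over commutative rings. *)
Definition qinvertible n (B : 'M[H]_n) : Prop :=
  exists C : 'M[H]_n, B *m C = 1%:M /\ C *m B = 1%:M.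

Definition frob_norm m n (M : 'M[H]_(m, n)) : R :=
  Num.sqrt (\sum_i \sum_j normq2 (M i j)).

Definition orthonormal_cols m n (M : 'M[H]_(m, n)) : Prop :=
  adjq M *m M = 1%:M.

(* The two equations force m = p; allowing distinct (but equal) m and p makes
   the predicate applicable to row_mx U1 U2 : 'M_(m, r + (m - r)) without a
   cast. *)
Definition qunitary m p (U : 'M[H]_(m, p)) : Prop :=
  adjq U *m U = 1%:M /\ U *m adjq U = 1%:M.

Definition is_qsvd m n p q (A : 'M[H]_(m, n))
    (U : 'M[H]_(m, p)) (S : 'M[R]_(p, q)) (V : 'M[H]_(n, q)) : Prop :=
  [/\ qunitary U /\ qunitary V,
      is_diag_mx S,
      forall (i : 'I_p) (j : 'I_q), i = j :> nat -> 0 <= S i j,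
      forall (i i' : 'I_p) (j j' : 'I_q),
        i = j :> nat -> i' = j' :> nat -> (i <= i')%N -> S i' j' <= S i j &
      A = U *m qreal_mx S *m adjq V].

Definition singular_values m n (A : 'M[H]_(m, n)) : set R :=
  [set sigma | exists (U : 'M[H]_m) (S : 'M[R]_(m, n)) (V : 'M[H]_n),
    is_qsvd A U S V /\
    exists (i : 'I_m) (j : 'I_n), i = j :> nat /\ sigma = S i j]%classic.

(* The set is finite, so sup is a maximum; it is 0 for an empty matrix. *)
Definition spec_norm m n (A : 'M[H]_(m, n)) : R := sup (singular_values A).

Definition penrose m n (M : 'M[H]_(m, n)) (X : 'M[H]_(n, m)) : Prop :=
  [/\ M *m X *m M = M,
      X *m M *m X = X,
      adjq (M *m X) = M *m X &
      adjq (X *m M) = X *m M].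

(* The default value 0 of xget is never used: every quaternion matrix has
   exactly one Moore-Penrose inverse. *)
Definition pinvq m n (M : 'M[H]_(m, n)) : 'M[H]_(n, m) :=
  xget 0 [set X | penrose M X]%classic.

End QuaternionMatrix.

(* Main.v *)
Require Import Defs.
From HB Require Import structures.
From mathcomp Require Import all_boot all_order all_algebra.
From mathcomp Require Import boolp classical_sets reals.
From mathcomp Require Import topology normedtype derive.
From mathcomp Require Import ring lra.

Set Implicit Arguments.
Unset Strict Implicit.
Unset Printing Implicit Defensive.

Import Order.TTheory GRing.Theory Num.Theory.
Import numFieldNormedType.Exports.
Local Open Scope ring_scope.

(* Two orthogonal errors: H X = Q Q^* A + Q Psi2^+ Psi1 Qp^* A, which gives the
   equality. For the bound, 1 - Q Q^* annihilates A Omega, hence sends A and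
   A (1 - Omega Omega1^+ V1^* ) to the same matrix; being a contraction, it
   yields the norm of Sigma2 [- Omega2 Omega1^+, 1] as a bound.
   The spectral norm is a supremum over singular value decompositions, so its
   submultiplicativity with the Frobenius norm needs a decomposition to exist.
   It is built by deflation: compactness of the unit sphere gives a vector on
   which A attains its operator norm, and unitary completions of this vector
   and of its image split off a 1 x 1 block. The same deflation produces the
   Moore-Penrose inverse. *)

(** * Conjugation and the multiplicative norm on quaternions *)

Section QuaternionScalars.
Variable R : comNzRingType.
Local Notation H := (quaternion R).
Implicit Types p q : H.

Lemma conjqK : involutive (@conjq R).
Proof. by case=> a b c d; congr Quat => /=; ring. Qed.

Lemma conjqM p q : conjq (p * q) = conjq q * conjq p.
Proof. by case: p q => [a b c d] [a' b' c' d']; congr Quat => /=; ring. Qed.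

Lemma conjq_realq (a : R) : conjq (realq a) = realq a.
Proof. by congr Quat => /=; ring. Qed.

Fact conjq_is_zmod_morphism : zmod_morphism (@conjq R).
Proof. by case=> [a b c d] [a' b' c' d']; congr Quat => /=; ring. Qed.

HB.instance Definition _ :=
  GRing.isZmodMorphism.Build H H (@conjq R) conjq_is_zmod_morphism.

Fact qre_is_zmod_morphism : zmod_morphism (@qre R).
Proof. by []. Qed.

HB.instance Definition _ :=
  GRing.isZmodMorphism.Build H R (@qre R) qre_is_zmod_morphism.

Fact realq_is_zmod_morphism : zmod_morphism (@realq R).
Proof. by move=> a b; congr Quat => /=; ring. Qed.

HB.instance Definition _ :=
  GRing.isZmodMorphism.Build R H (@realq R) realq_is_zmod_morphism.

Fact realq_is_monoid_morphism : monoid_morphism (@realq R).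
Proof. by split=> // a b; congr Quat => /=; ring. Qed.

HB.instance Definition _ :=
  GRing.isMonoidMorphism.Build R H (@realq R) realq_is_monoid_morphism.

Lemma conjq1 : conjq (1 : H) = 1.
Proof. exact: conjq_realq. Qed.

Lemma mul_conjq q : conjq q * q = realq (normq2 q).
Proof. by case: q => a b c d; congr Quat => /=; rewrite /normq2 /=; ring. Qed.

Lemma mulq_conj q : q * conjq q = realq (normq2 q).
Proof. by case: q => a b c d; congr Quat => /=; rewrite /normq2 /=; ring. Qed.

Lemma normq2_conj q : normq2 (conjq q) = normq2 q.
Proof. by rewrite /normq2 /=; ring. Qed.

Lemma normq2M p q : normq2 (p * q) = normq2 p * normq2 q.
Proof. by case: p q => [a b c d] [a' b' c' d']; rewrite /normq2 /=; ring. Qed.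

Lemma normq2_realq (a : R) : normq2 (realq a) = a ^+ 2.
Proof. by rewrite /normq2 /=; ring. Qed.

Lemma normq20 : normq2 (0 : H) = 0.
Proof. by rewrite /normq2 /= ; ring. Qed.

Lemma realq_comm (a : R) q : realq a * q = q * realq a.
Proof. by case: q => [b c d e]; congr Quat => /=; ring. Qed.

End QuaternionScalars.

Lemma normq2_ge0 (R : realDomainType) (q : quaternion R) : 0 <= normq2 q.
Proof. by rewrite /normq2 !addr_ge0 ?sqr_ge0. Qed.

Lemma normq2_eq0 (R : realDomainType) (q : quaternion R) :
  (normq2 q == 0) = (q == 0).
Proof.
apply/eqP/eqP => [|->]; last exact: normq20.
case: q => a b c d; rewrite /normq2 /= => /eqP.
rewrite !paddr_eq0 ?addr_ge0 ?sqr_ge0 // !sqrf_eq0.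
by move=> /andP[/andP[/andP[/eqP -> /eqP ->] /eqP ->] /eqP ->].
Qed.

Lemma mulq_inv (R : realFieldType) (q : quaternion R) : q != 0 ->
  exists p, p * q = 1 /\ q * p = 1.
Proof.
rewrite -normq2_eq0 => q0; exists (conjq q * realq (normq2 q)^-1); split.
  by rewrite -mulrA realq_comm mulrA mul_conjq -rmorphM /= divff.
by rewrite mulrA mulq_conj -rmorphM /= divff.
Qed.

(** * Conjugate transposes and unitary matrices *)

Section Adjoint.
Variable R : realType.
Local Notation H := (quaternion R).

Lemma adjqE m n (M : 'M[H]_(m, n)) i j : adjq M i j = conjq (M j i).
Proof. by rewrite !mxE. Qed.

Lemma adjqK m n (M : 'M[H]_(m, n)) : adjq (adjq M) = M.
Proof. by apply/matrixP => i j; rewrite !adjqE conjqK. Qed.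

Lemma adjqM m n p (M : 'M[H]_(m, n)) (N : 'M[H]_(n, p)) :
  adjq (M *m N) = adjq N *m adjq M.
Proof.
apply/matrixP => i j; rewrite adjqE !mxE raddf_sum /=.
by apply: eq_bigr => k _; rewrite conjqM !adjqE.
Qed.

Lemma adjqD m n (M N : 'M[H]_(m, n)) : adjq (M + N) = adjq M + adjq N.
Proof. by apply/matrixP => i j; rewrite !mxE raddfD. Qed.

Lemma adjqN m n (M : 'M[H]_(m, n)) : adjq (- M) = - adjq M.
Proof. by apply/matrixP => i j; rewrite !mxE raddfN. Qed.

Lemma adjq0 m n : adjq (0 : 'M[H]_(m, n)) = 0.
Proof. by apply/matrixP => i j; rewrite adjqE !mxE raddf0. Qed.

Lemma adjq1 n : adjq (1%:M : 'M[H]_n) = 1%:M.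
Proof.
apply/matrixP => i j; rewrite adjqE !mxE eq_sym.
by case: (i == j); rewrite ?conjq1 ?raddf0.
Qed.

Lemma adjq_row_mx m n1 n2 (M : 'M[H]_(m, n1)) (N : 'M[H]_(m, n2)) :
  adjq (row_mx M N) = col_mx (adjq M) (adjq N).
Proof. by rewrite /adjq map_row_mx tr_row_mx. Qed.

Lemma adjq_col_mx m1 m2 n (M : 'M[H]_(m1, n)) (N : 'M[H]_(m2, n)) :
  adjq (col_mx M N) = row_mx (adjq M) (adjq N).
Proof. by rewrite /adjq map_col_mx tr_col_mx. Qed.

Lemma adjq_block_mx m1 m2 n1 n2 (M : 'M[H]_(m1, n1)) (N : 'M[H]_(m1, n2))
    (P : 'M[H]_(m2, n1)) (Q : 'M[H]_(m2, n2)) :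
  adjq (block_mx M N P Q) = block_mx (adjq M) (adjq P) (adjq N) (adjq Q).
Proof. by rewrite /adjq map_block_mx tr_block_mx. Qed.

Lemma adjq_qreal m n (S : 'M[R]_(m, n)) : adjq (qreal_mx S) = qreal_mx S^T.
Proof. by apply/matrixP => i j; rewrite adjqE !mxE conjq_realq. Qed.

Lemma qreal_block_mx m1 m2 n1 n2 (M : 'M[R]_(m1, n1)) (N : 'M[R]_(m1, n2))
    (P : 'M[R]_(m2, n1)) (Q : 'M[R]_(m2, n2)) :
  qreal_mx (block_mx M N P Q) =
  block_mx (qreal_mx M) (qreal_mx N) (qreal_mx P) (qreal_mx Q).
Proof. exact: map_block_mx. Qed.

Lemma qreal_mx0 m n : qreal_mx (0 : 'M[R]_(m, n)) = 0.
Proof. exact: map_mx0. Qed.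

Lemma qunitary1 n : qunitary (1%:M : 'M[H]_n).
Proof. by split; rewrite adjq1 mul1mx. Qed.

Lemma qunitaryM m n p (U : 'M[H]_(m, n)) (V : 'M[H]_(n, p)) :
  qunitary U -> qunitary V -> qunitary (U *m V).
Proof.
case=> u1 u2 [v1 v2]; split; rewrite adjqM mulmxA.
  by rewrite -(mulmxA (adjq V)) u1 mulmx1.
by rewrite -(mulmxA U) v2 mulmx1.
Qed.

Lemma qunitary_block m1 m2 n1 n2 (U : 'M[H]_(m1, n1)) (V : 'M[H]_(m2, n2)) :
  qunitary U -> qunitary V -> qunitary (block_mx U 0 0 V).
Proof.
case=> u1 u2 [v1 v2]; split; rewrite adjq_block_mx !adjq0 mulmx_block.
  by rewrite !mulmx0 !mul0mx !addr0 add0r u1 v1 -scalar_mx_block.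
by rewrite !mulmx0 !mul0mx !addr0 add0r u2 v2 -scalar_mx_block.
Qed.

End Adjoint.

(** * The squared Frobenius norm: isometries, orthogonality, diagonal factors *)

Section FrobeniusSquare.
Variable R : realType.
Local Notation H := (quaternion R).

(** Working with the square keeps the norm polynomial in the real coordinates of the entries. *)
Definition frob2 m n (M : 'M[H]_(m, n)) : R := \sum_i \sum_j normq2 (M i j).

Lemma frob2_ge0 m n (M : 'M[H]_(m, n)) : 0 <= frob2 M.
Proof. by do 2! [apply: sumr_ge0 => ? _]; apply: normq2_ge0. Qed.

Lemma frob_norm_sqr m n (M : 'M[H]_(m, n)) : frob_norm M ^+ 2 = frob2 M.
Proof. by rewrite sqr_sqrtr // frob2_ge0. Qed.

Lemma frob20 m n : frob2 (0 : 'M[H]_(m, n)) = 0.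
Proof. by apply: big1 => i _; apply: big1 => j _; rewrite mxE normq20. Qed.

Lemma normq2_le_frob2 m n (M : 'M[H]_(m, n)) i j : normq2 (M i j) <= frob2 M.
Proof.
rewrite /frob2 (bigD1 i) //= (bigD1 j) //= -addrA lerDl addr_ge0 //.
  by apply: sumr_ge0 => *; apply: normq2_ge0.
by apply: sumr_ge0 => *; apply: sumr_ge0 => *; apply: normq2_ge0.
Qed.

Lemma frob2_eq0 m n (M : 'M[H]_(m, n)) : frob2 M = 0 -> M = 0.
Proof.
move=> M0; apply/matrixP => i j; rewrite mxE; apply/eqP.
by rewrite -normq2_eq0 eq_le normq2_ge0 -M0 normq2_le_frob2.
Qed.

Lemma frob2_adj m n (M : 'M[H]_(m, n)) : frob2 (adjq M) = frob2 M.
Proof.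
rewrite /frob2 exchange_big; apply: eq_bigr => i _; apply: eq_bigr => j _.
by rewrite adjqE normq2_conj.
Qed.

Lemma frob2N m n (M : 'M[H]_(m, n)) : frob2 (- M) = frob2 M.
Proof.
apply: eq_bigr => i _; apply: eq_bigr => j _.
by rewrite mxE /normq2 /= !sqrrN.
Qed.

Lemma gram_diag m n (M : 'M[H]_(m, n)) j :
  (adjq M *m M) j j = realq (\sum_i normq2 (M i j)).
Proof.
rewrite mxE raddf_sum; apply: eq_bigr => i _.
by rewrite adjqE mul_conjq.
Qed.

(** Through the Gram matrix, isometry and orthogonality become plain matrix identities. *)
Lemma frob2_gram m n (M : 'M[H]_(m, n)) : frob2 M = qre (\tr (adjq M *m M)).
Proof.
rewrite /frob2 exchange_big /mxtrace raddf_sum; apply: eq_bigr => j _.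
by rewrite gram_diag.
Qed.

Lemma frob2_isol m n p (U : 'M[H]_(m, n)) (M : 'M[H]_(n, p)) :
  adjq U *m U = 1%:M -> frob2 (U *m M) = frob2 M.
Proof.
by move=> hU; rewrite !frob2_gram adjqM mulmxA -(mulmxA _ _ U) hU mulmx1.
Qed.

(** Deduced by adjoints rather than by cycling the trace, which is not cyclic over a noncommutative
    ring. *)
Lemma frob2_isor m n p (M : 'M[H]_(m, n)) (V : 'M[H]_(n, p)) :
  V *m adjq V = 1%:M -> frob2 (M *m V) = frob2 M.
Proof.
move=> hV; rewrite -frob2_adj adjqM frob2_isol ?frob2_adj //.
by rewrite adjqK.
Qed.

Lemma frob2_pythagoras m n (M N : 'M[H]_(m, n)) :
  adjq M *m N = 0 -> frob2 (M + N) = frob2 M + frob2 N.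
Proof.
move=> MN; have NM : adjq N *m M = 0 by rewrite -(adjqK M) -adjqM MN adjq0.
rewrite !frob2_gram adjqD mulmxDl !mulmxDr MN NM addr0 add0r.
by rewrite mxtraceD raddfD.
Qed.

Lemma frob2_col_mx m1 m2 n (M : 'M[H]_(m1, n)) (N : 'M[H]_(m2, n)) :
  frob2 (col_mx M N) = frob2 M + frob2 N.
Proof.
rewrite /frob2 big_split_ord /=; congr (_ + _); apply: eq_bigr => i _;
  by apply: eq_bigr => j _; rewrite (col_mxEu, col_mxEd).
Qed.

Lemma frob2_row_mx m n1 n2 (M : 'M[H]_(m, n1)) (N : 'M[H]_(m, n2)) :
  frob2 (row_mx M N) = frob2 M + frob2 N.
Proof. by rewrite -frob2_adj adjq_row_mx frob2_col_mx !frob2_adj. Qed.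

Lemma gram_col n (v : 'cV[H]_n) : adjq v *m v = (realq (frob2 v))%:M.
Proof.
apply/matrixP => i j; rewrite !ord1 gram_diag mxE eqxx mulr1n.
by congr realq; apply: eq_bigr => k _; rewrite big_ord1.
Qed.

Lemma frob2_mul_real n (v : 'cV[H]_n) (a : R) :
  frob2 (v *m (realq a)%:M) = a ^+ 2 * frob2 v.
Proof.
rewrite /frob2 mulr_sumr; apply: eq_bigr => i _; rewrite !big_ord1 mxE big_ord1.
by rewrite mxE eqxx mulr1n normq2M normq2_realq mulrC.
Qed.

Lemma frob2_real (a : R) : frob2 ((realq a)%:M : 'M[H]_1) = a ^+ 2.
Proof. by rewrite /frob2 !big_ord1 mxE eqxx mulr1n normq2_realq. Qed.

(* Row i of the product is a multiple of row i of N. *)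
Lemma frob2_diag_mul m n p (S : 'M[R]_(m, n)) (c : R) (N : 'M[H]_(n, p)) :
  is_diag_mx S ->
  (forall (i : 'I_m) (j : 'I_n), i = j :> nat -> S i j ^+ 2 <= c) -> 0 <= c ->
  frob2 (qreal_mx S *m N) <= c * frob2 N.
Proof.
move=> /is_diag_mxP dS hS c0.
(* This indicator of the diagonal writes the row estimate as a sum over all [j]. The estimate then
   also covers the rows [i >= n], where the product vanishes, and the sums can be exchanged. *)
pose e (i : 'I_m) (j : 'I_n) : R := (i == j :> nat)%:R.
have row_le i k : normq2 ((qreal_mx S *m N) i k)
    <= \sum_j e i j * (c * normq2 (N j k)).
  rewrite mxE; have [i_n|n_i] := ltnP i n; last first.
    rewrite big1 ?normq20.
      by apply: sumr_ge0 => j _; rewrite !mulr_ge0 ?ler0n ?normq2_ge0.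
    move=> j _; rewrite mxE dS ?raddf0 ?mul0r //=.
    by rewrite neq_ltn (leq_trans (ltn_ord j) n_i) orbT.
  have ne j : j != Ordinal i_n -> (i == j :> nat) = false.
    by move=> h; apply: contraNF h => /eqP h; apply/eqP/val_inj.
  rewrite (bigD1 (Ordinal i_n)) //= [X in _ + X]big1 ?addr0; last first.
    by move=> j /ne h; rewrite mxE dS ?h // raddf0 mul0r.
  rewrite (bigD1 (Ordinal i_n)) //= [X in _ + X]big1 ?addr0; last first.
    by move=> j /ne h; rewrite /e h mul0r.
  by rewrite /e eqxx mul1r normq2M mxE normq2_realq ler_wpM2r ?normq2_ge0 ?hS.
(* A row [j] of [N] is met by at most one row of [S], and by none when [m <= j]. *)
have e_le1 j : \sum_i e i j <= 1.
  have [j_m|m_j] := ltnP j m.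
    rewrite (bigD1 (Ordinal j_m)) //= big1 ?addr0 /e ?eqxx // => i h.
    suff -> : (i == j :> nat) = false by [].
    by apply: contraNF h => /eqP h; apply/eqP/val_inj.
  rewrite big1 // => i _; rewrite /e.
  by rewrite (ltn_eqF (leq_trans (ltn_ord i) m_j)).
rewrite /frob2 mulr_sumr.
under [leRHS]eq_bigr do rewrite mulr_sumr.
apply: (@le_trans _ _ (\sum_i \sum_k \sum_j e i j * (c * normq2 (N j k)))).
  by apply: ler_sum => i _; apply: ler_sum => k _; apply: row_le.
rewrite exchange_big [leRHS]exchange_big; apply: ler_sum => k _.
rewrite exchange_big; apply: ler_sum => j _ /=.
by rewrite -mulr_suml ler_piMl ?mulr_ge0 ?normq2_ge0.
Qed.

End FrobeniusSquare.

(** * Continuity of quaternion-valued functions *)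

Section QuaternionContinuity.
Variables (R : realType) (T : topologicalType).
Local Notation H := (quaternion R).

(** Continuity of the four real coordinates stands in for a topology on the quaternions. *)
Definition qcontinuous (f : T -> H) : Prop :=
  [/\ continuous (fun x => qre (f x)), continuous (fun x => qim (f x)),
      continuous (fun x => qjm (f x)) & continuous (fun x => qkm (f x))].

Lemma qcontinuousD (f g : T -> H) :
  qcontinuous f -> qcontinuous g -> qcontinuous (fun x => f x + g x).
Proof.
by case=> [f1 f2 f3 f4] [g1 g2 g3 g4]; split => x /=; apply: continuousD;
  [exact: f1|exact: g1|exact: f2|exact: g2
  |exact: f3|exact: g3|exact: f4|exact: g4].
Qed.

Lemma qcontinuousMl (a : H) (f : T -> H) :
  qcontinuous f -> qcontinuous (fun x => a * f x).
Proof.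
case=> f1 f2 f3 f4.
have K (c : R) (g : T -> R) : continuous g -> continuous (fun x => c * g x).
  by move=> hg x; apply: continuousM; [exact: cst_continuous|exact: hg].
have D (g h : T -> R) : continuous g -> continuous h ->
    continuous (fun x => g x + h x).
  by move=> hg hh x; apply: continuousD; [exact: hg|exact: hh].
have B (g h : T -> R) : continuous g -> continuous h ->
    continuous (fun x => g x - h x).
  by move=> hg hh x; apply: continuousB; [exact: hg|exact: hh].
split.
- by apply: (B _ _ (B _ _ (B _ _ (K (qre a) _ f1) (K (qim a) _ f2))
    (K (qjm a) _ f3)) (K (qkm a) _ f4)).
- by apply: (B _ _ (D _ _ (D _ _ (K (qre a) _ f2) (K (qim a) _ f1))
    (K (qjm a) _ f4)) (K (qkm a) _ f3)).
- by apply: (D _ _ (D _ _ (B _ _ (K (qre a) _ f3) (K (qim a) _ f4))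
    (K (qjm a) _ f1)) (K (qkm a) _ f2)).
- by apply: (D _ _ (B _ _ (D _ _ (K (qre a) _ f4) (K (qim a) _ f3))
    (K (qjm a) _ f2)) (K (qkm a) _ f1)).
Qed.

Lemma qcontinuous_sum (I : finType) (F : I -> T -> H) :
  (forall i, qcontinuous (F i)) -> qcontinuous (fun x => \sum_i F i x).
Proof.
move=> hF.
have : qcontinuous (fun x => \sum_(i <- index_enum I) F i x).
  elim: (index_enum I) => [|i e IH].
    under eq_fun do rewrite big_nil.
    by split => x; apply: cst_continuous.
  under eq_fun do rewrite big_cons.
  exact: qcontinuousD.
by [].
Qed.

Lemma normq2_continuous (f : T -> H) :
  qcontinuous f -> continuous (fun x => normq2 (f x)).
Proof.
case=> f1 f2 f3 f4; rewrite /normq2.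
have S (g : T -> R) : continuous g -> continuous (fun x => g x ^+ 2).
  by move=> hg x; apply: (@continuousM _ _ g g); exact: hg.
have D (g h : T -> R) : continuous g -> continuous h ->
    continuous (fun x => g x + h x).
  by move=> hg hh x; apply: continuousD; [exact: hg|exact: hh].
by apply: (D _ _ (D _ _ (D _ _ (S _ f1) (S _ f2)) (S _ f3)) (S _ f4)).
Qed.

Lemma frob2_continuous m n (F : T -> 'M[H]_(m, n)) :
  (forall i j, qcontinuous (fun x => F x i j)) ->
  continuous (fun x => frob2 (F x)).
Proof.
move=> hF.
have Z (I : finType) (G : I -> T -> R) : (forall i, continuous (G i)) ->
    continuous (fun x => \sum_i G i x).
  move=> hG; have : continuous (fun x => \sum_(i <- index_enum I) G i x).
    elim: (index_enum I) => [|i e IH].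
      under eq_fun do rewrite big_nil.
      exact: cst_continuous.
    under eq_fun do rewrite big_cons.
    by move=> x; apply: continuousD; [exact: hG|exact: IH].
  by [].
by apply: (Z) => i; apply: (Z) => j; exact: normq2_continuous.
Qed.

End QuaternionContinuity.

(** * Attainment of the operator norm on the unit sphere *)

Section SphereMaximum.
Variable R : realType.
Local Notation H := (quaternion R).

(** Real coordinates of a quaternion vector, laid out as one real row vector so that compactness and
    the extreme value theorem apply. *)
Definition qvec_of_real n (x : 'rV[R]_(4 * n)) : 'cV[H]_n :=
  \col_i Quat (vec_mx x (inord 0) i) (vec_mx x (inord 1) i)
              (vec_mx x (inord 2) i) (vec_mx x (inord 3) i).

Lemma qvec_of_real_surj n (v : 'cV[H]_n) : exists x, qvec_of_real x = v.
Proof.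
pose c (q : H) := [:: qre q; qim q; qjm q; qkm q].
exists (mxvec (\matrix_(a < 4, i < n) nth 0 (c (v i 0)) a)).
apply/matrixP => i j; rewrite ord1 mxE mxvecK !mxE !inordK //=.
by case: (v i 0).
Qed.

(** Each coordinate contributes one of the squares in the sum; this makes the unit sphere
    bounded. *)
Lemma entry_le_frob2 n (x : 'rV[R]_(4 * n)) k :
  x 0 k ^+ 2 <= frob2 (qvec_of_real x).
Proof.
case/mxvec_indexP: k => a i.
apply: le_trans (normq2_le_frob2 _ i 0).
have -> : x 0 (mxvec_index a i) = vec_mx x a i by rewrite mxE.
rewrite [qvec_of_real x i 0]mxE /normq2 /=.
have h (y : R) : 0 <= y ^+ 2 by apply: sqr_ge0.
have := (h (vec_mx x (inord 0) i), h (vec_mx x (inord 1) i),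
  h (vec_mx x (inord 2) i), h (vec_mx x (inord 3) i)).
rewrite -[a]inord_val; case: a => [[|[|[|[|//]]]]] /= _ [[[]]] *; lra.
Qed.

Lemma qvec_of_real_continuous n i j :
  qcontinuous (fun x : 'rV[R]_(4 * n) => qvec_of_real x i j).
Proof.
split; under eq_fun do rewrite !mxE; exact: coord_continuous.
Qed.

(** The sphere is closed and bounded in real coordinates, hence compact, and the squared length of
    the image is continuous. The dimension [n.+1] keeps the sphere nonempty. *)
Lemma sphere_max m n (A : 'M[H]_(m, n.+1)) :
  exists2 v : 'cV[H]_n.+1, frob2 v = 1 &
    forall w : 'cV[H]_n.+1, frob2 w = 1 -> frob2 (A *m w) <= frob2 (A *m v).
Proof.
pose f (x : 'rV[R]_(4 * n.+1)) := frob2 (A *m qvec_of_real x).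
pose K : set 'rV[R]_(4 * n.+1) := [set x | frob2 (qvec_of_real x) = 1]%classic.
have cN : continuous (fun x : 'rV[R]_(4 * n.+1) => frob2 (qvec_of_real x)).
  by apply: frob2_continuous => i j; apply: qvec_of_real_continuous.
have cf : continuous f.
  apply: frob2_continuous => i j; under eq_fun do rewrite mxE.
  apply: qcontinuous_sum => k; apply: qcontinuousMl.
  exact: qvec_of_real_continuous.
have K0 : (K !=set0)%classic.
  have [x hx] := qvec_of_real_surj (delta_mx 0 0 : 'cV[H]_n.+1).
  exists x; rewrite /K /= hx /frob2 (bigD1 0) //= big_ord1 mxE !eqxx.
  rewrite (normq2_realq (1 : R)) expr1n big1 ?addr0 // => i i0.
  by rewrite big_ord1 mxE (negPf i0) normq20.
have Kc : compact K.
  apply: bounded_closed_compact.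
    (* Coordinates of a point of the sphere have absolute value at most 1, so every [M > 1] bounds
       the sup norm. *)
    exists 1; split => // M M1 x Kx; rewrite /= [leLHS]/Num.norm /= mx_normrE.
    apply/bigmax_leP; split=> [|[i j] _ /=].
      exact: ltW (lt_trans ltr01 M1).
    rewrite ord1 (le_trans _ (ltW M1)) // -(ler_pXn2r (n := 2)) ?nnegrE //.
    by rewrite expr1n real_normK ?num_real // -Kx entry_le_frob2.
  have -> : K = ((fun x => frob2 (qvec_of_real x)) @^-1` [set 1])%classic by [].
  by apply: preimage_closed => [x _|]; [exact: cN|exact: closed_eq].
have [x Kx max] := EVT_max_rV K0 Kc (continuous_subspaceT cf).
exists (qvec_of_real x); first by move: Kx; rewrite inE.
move=> w hw; have [y hy] := qvec_of_real_surj w.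
by rewrite -hy; apply: max; rewrite inE /K /= hy.
Qed.

(** By homogeneity: a nonzero [w] is scaled to the unit sphere by a real factor. *)
Lemma operator_bound_attained m n (A : 'M[H]_(m, n.+1)) :
  exists2 v : 'cV[H]_n.+1, frob2 v = 1 &
    forall w : 'cV[H]_n.+1, frob2 (A *m w) <= frob2 (A *m v) * frob2 w.
Proof.
have [v v1 vmax] := sphere_max A; exists v => // w.
have [w0|w0] := eqVneq (frob2 w) 0.
  by rewrite (frob2_eq0 w0) mulmx0 !frob20 mulr0.
have w_gt0 : 0 < frob2 w by rewrite lt_neqAle eq_sym w0 frob2_ge0.
pose a := (Num.sqrt (frob2 w))^-1.
have a2 : a ^+ 2 = (frob2 w)^-1 by rewrite /a exprVn sqr_sqrtr ?frob2_ge0.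
have := vmax (w *m (realq a)%:M).
rewrite mulmxA !frob2_mul_real a2 mulVf // => /(_ erefl).
by rewrite mulrC ler_pdivrMr.
Qed.

End SphereMaximum.

(** * Existence of singular value decompositions by deflation *)

Section SingularValueDecomposition.
Variable R : realType.
Local Notation H := (quaternion R).

Lemma qmx1_inv (d : 'M[H]_1) : d != 0 ->
  exists c : 'M[H]_1, c *m d = 1%:M /\ d *m c = 1%:M.
Proof.
move=> d0; have : d 0 0 != 0.
  by apply: contraNneq d0 => h; apply/eqP/matrixP => i j; rewrite !ord1 mxE.
case/mulq_inv => p [h1 h2]; exists p%:M; split; apply/matrixP => i j;
  by rewrite !ord1 !mxE big_ord1 !mxE eqxx !mulr1n.
Qed.

(* The reflection-like matrix 1 - w c w^* with w = u - e1 and c the inverse of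
   1 - (the conjugate of the first entry of u); no phase correction of u is
   needed because c may be a non-real quaternion. *)
Lemma unit_vector_extension n (u : 'cV[H]_(1 + n)) :
  adjq u *m u = 1%:M -> exists U2 : 'M[H]_(1 + n, n), qunitary (row_mx u U2).
Proof.
move=> u1; pose e : 'cV[H]_(1 + n) := col_mx 1%:M 0.
have e1 : adjq e *m e = 1%:M.
  by rewrite adjq_col_mx adjq1 adjq0 mul_row_col mul1mx mul0mx addr0.
(* A unitary [V] that maps the first basis vector to [u] has [u] as its first column; the other
   columns are the extension. *)
have first_col (V : 'M[H]_(1 + n)) : qunitary V -> V *m e = u ->
    exists U2 : 'M[H]_(1 + n, n), qunitary (row_mx u U2).
  move=> hV Ve; exists (rsubmx V); suff <- : lsubmx V = u by rewrite hsubmxK.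
  by rewrite -Ve -{2}[V]hsubmxK mul_row_col mulmx1 mulmx0 addr0.
pose w := u - e; pose d := 1%:M - adjq u *m e.
have we : adjq w *m e = - d by rewrite adjqD adjqN mulmxDl mulNmx e1 opprB.
have ww : adjq w *m w = d + adjq d.
  rewrite {2}/w mulmxBr we opprK /w adjqD adjqN mulmxDl mulNmx u1.
  by rewrite addrC /d adjqD adjqN adjqM adjqK adjq1.
have ew : e + w = u by rewrite addrC subrK.
clearbody w d.
(* If [d = 0], then [w] has norm zero, so [u] is already [e] and the identity does. *)
have [d0|/qmx1_inv [c [cd dc]]] := eqVneq d 0.
  apply: (first_col 1%:M); first exact: qunitary1.
  have : frob2 w = 0 by rewrite frob2_gram ww d0 adjq0 addr0 raddf0.
  by rewrite mul1mx -ew => /frob2_eq0 ->; rewrite addr0.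
have cd' : adjq d *m adjq c = 1%:M by rewrite -adjqM cd adjq1.
have dc' : adjq c *m adjq d = 1%:M by rewrite -adjqM dc adjq1.
have aV : adjq (1%:M - w *m c *m adjq w) = 1%:M - w *m adjq c *m adjq w.
  by rewrite adjqD adjqN adjq1 !adjqM adjqK mulmxA.
(* As [adjq w *m w = d + adjq d], the quadratic term of the product is
   [w *m (a *m (d + adjq d) *m b) *m adjq w]; the hypothesis makes it cancel the two linear
   terms. *)
have cancel a b : a *m (d + adjq d) *m b = a + b ->
    (1%:M - w *m a *m adjq w) *m (1%:M - w *m b *m adjq w) = 1%:M.
  move=> hab; set P := w *m a *m _; set P' := w *m b *m _.
  have PP' : P *m P' = P + P'.
    rewrite {}/P {}/P' -mulmxDl -mulmxDr -hab -ww.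
    by rewrite !mulmxA.
  by rewrite mulmxBl mul1mx mulmxBr mulmx1 PP' opprB [P + P']addrC addrK subrK.
(* This matrix sends [e] to [e + w = u], because [adjq w *m e = - d] and [c] inverts [d]. *)
apply: (first_col (1%:M - w *m c *m adjq w)); last first.
  by rewrite mulmxBl mul1mx -!mulmxA we !mulmxN cd mulmx1 opprK.
split; rewrite aV; apply: cancel.
  by rewrite mulmxDr mulmxDl dc' mul1mx -mulmxA dc mulmx1 addrC.
by rewrite mulmxDr cd mulmxDl mul1mx -mulmxA cd' mulmx1 addrC.
Qed.

(* One step of the decomposition: s is the norm of A as an operator, attained
   at a unit vector v with A v = u s; the entries to the right of s vanish
   because they would make the first row longer than s. *)
Lemma svd_step m n (A : 'M[H]_(1 + m, 1 + n)) :
  exists (U : 'M[H]_(1 + m)) (V : 'M[H]_(1 + n)) (s : R) (B : 'M[H]_(m, n)),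
  [/\ qunitary U /\ qunitary V, 0 <= s,
      forall x : 'cV[H]_(1 + n), frob2 (A *m x) <= s ^+ 2 * frob2 x &
      A = U *m block_mx (realq s)%:M 0 0 B *m adjq V].
Proof.
have [v v1 vmax] := operator_bound_attained A.
pose s := Num.sqrt (frob2 (A *m v)).
have s0 : 0 <= s by apply: sqrtr_ge0.
have s2 : s ^+ 2 = frob2 (A *m v) by rewrite sqr_sqrtr ?frob2_ge0.
rewrite -s2 in vmax.
have [u u1 Av] : exists2 u : 'cV[H]_(1 + m), frob2 u = 1 &
    A *m v = u *m (realq s)%:M.
  (* If [s = 0], the image of [v] is zero and any unit [u] does; otherwise [u] is the normalised
     image. *)
  have [sz|snz] := eqVneq s 0.
    exists (col_mx 1%:M 0).
      by rewrite frob2_col_mx frob20 addr0 (frob2_real 1) expr1n.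
    rewrite [LHS]frob2_eq0 -?s2 ?sz ?expr0n //; apply/esym/frob2_eq0.
    by rewrite frob2_mul_real expr0n mul0r.
  exists (A *m v *m (realq s^-1)%:M).
    by rewrite frob2_mul_real -s2 exprVn mulVf // sqrf_eq0.
  by rewrite -mulmxA -scalar_mxM -rmorphM /= mulVf // mulmx1.
have [U2 hU] : exists U2 : 'M[H]_(1 + m, m), qunitary (row_mx u U2).
  by apply: unit_vector_extension; rewrite gram_col u1.
have [V2 hV] : exists V2 : 'M[H]_(1 + n, n), qunitary (row_mx v V2).
  by apply: unit_vector_extension; rewrite gram_col v1.
set U := row_mx u U2 in hU; set V := row_mx v V2 in hV.
pose w := adjq u *m A *m V2; pose B := adjq U2 *m A *m V2.
have defM : adjq U *m A *m V = block_mx (realq s)%:M w 0 B.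
  rewrite adjq_row_mx -mulmxA mul_mx_row mul_col_row !mulmxA.
  have [+ _] := hU; rewrite adjq_row_mx mul_col_row scalar_mx_block.
  case/eq_block_mx => hu _ hu2 _.
  by congr block_mx; rewrite -mulmxA Av mulmxA (hu, hu2) (mul1mx, mul0mx).
have Mbound (x : 'cV[H]_(1 + n)) :
    frob2 (block_mx (realq s)%:M w 0 B *m x) <= s ^+ 2 * frob2 x.
  rewrite -defM -!mulmxA frob2_isol; last by rewrite adjqK; case: hU.
  by apply: le_trans (vmax _) _; rewrite frob2_isol //; case: hV.
have w0 : w = 0.
  have ww : w *m adjq w = (realq (frob2 w))%:M.
    by rewrite -{1}[w]adjqK gram_col frob2_adj.
  (* With [t = frob2 w], this test vector has squared length [s ^+ 2 + t], and its image has first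
     entry [s ^+ 2 + t]. The bound gives [(s ^+ 2 + t) ^+ 2 <= s ^+ 2 * (s ^+ 2 + t)], which forces
     [t = 0]. *)
  apply: frob2_eq0; have := Mbound (col_mx (realq s)%:M (adjq w)).
  rewrite mul_block_col mul0mx add0r !frob2_col_mx ww -scalar_mxM -rmorphM /=.
  rewrite -raddfD /= -raddfD /= !frob2_real frob2_adj.
  have := frob2_ge0 (B *m adjq w); have := frob2_ge0 w.
  move: (frob2 w) (frob2 (B *m _)) => t b t0 b0 h.
  have h2 : (s * s + t) * t <= 0.
    have : (s * s + t) ^+ 2 <= s ^+ 2 * (s ^+ 2 + t).
      by apply: le_trans h; rewrite lerDl.
    rewrite -subr_ge0 => h1; rewrite -subr_ge0; apply: le_trans h1 _.
    by rewrite le_eqVlt; apply/orP; left; apply/eqP; ring.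
  apply/eqP; rewrite eq_le t0 andbT leNgt; apply/negP => tp.
  move: h2; rewrite leNgt => /negP; apply; apply: mulr_gt0 => //.
  by apply: ltr_wpDl => //; apply: mulr_ge0.
exists U, V, s, B; split; [by split | exact: s0 | exact: vmax |].
rewrite -{1}w0 -defM !mulmxA; case: hU => _ ->; rewrite mul1mx -mulmxA.
by case: hV => _ ->; rewrite mulmx1.
Qed.

(** Column [j] of [S] is as long as the image under [A] of the unit vector [V *m delta_mx j 0]. In
    the deflation this keeps the later singular values below the one split off first. *)
Lemma svd_entry_le m n (A : 'M[H]_(m, n)) (U : 'M[H]_m) (S : 'M[R]_(m, n))
    (V : 'M[H]_n) (c : R) :
  is_qsvd A U S V -> 0 <= c ->
  (forall x : 'cV[H]_n, frob2 (A *m x) <= c ^+ 2 * frob2 x) ->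
  forall i j, S i j <= c.
Proof.
move=> [[[U1 _] [V1 V2]] _ _ _ ->] c0 hc i j.
have := hc (V *m delta_mx j 0).
rewrite -!mulmxA (mulmxA _ V) V1 mul1mx.
rewrite (frob2_isol _ U1) (frob2_isol _ V1) => h.
have hS : S i j ^+ 2 <= c ^+ 2.
  have := normq2_le_frob2 (qreal_mx S *m delta_mx j (0 : 'I_1)) i 0.
  rewrite -colE mxE mxE normq2_realq => /le_trans; apply.
  rewrite colE; apply: le_trans h _.
  rewrite ler_piMr ?sqr_ge0 // /frob2 (bigD1 j) //= big_ord1 mxE !eqxx.
  rewrite (normq2_realq (1 : R)) expr1n big1 ?addr0 // => k kj.
  by rewrite big_ord1 mxE (negPf kj) normq20.
have := hS; rewrite -[X in X <= _]real_normK ?num_real //.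
by rewrite ler_pXn2r ?nnegrE //; apply: le_trans (ler_norm _).
Qed.

Lemma qsvd_exists m n (A : 'M[H]_(m, n)) :
  exists (U : 'M[H]_m) (S : 'M[R]_(m, n)) (V : 'M[H]_n), is_qsvd A U S V.
Proof.
elim: m n A => [|m IH] [|n] A.
- exists 1%:M, 0, 1%:M; split; [by split; apply: qunitary1| | by case|by case|].
    by apply/is_diag_mxP => -[].
  by apply/matrixP => -[].
- exists 1%:M, 0, 1%:M; split; [by split; apply: qunitary1| | by case|by case|].
    by apply/is_diag_mxP => -[].
  by apply/matrixP => -[].
- exists 1%:M, 0, 1%:M; split.
  + by split; apply: qunitary1.
  + by apply/is_diag_mxP => i -[].
  + by move=> i -[].
  + by move=> i i' -[].
  + by apply/matrixP => i -[].
rewrite -[m.+1]/(1 + m)%N -[n.+1]/(1 + n)%N in A *.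
have [U [V [s [B [[hU hV] s0 bound defA]]]]] := svd_step A.
have [U' [S' [V' svdB]]] := IH _ B.
(* Padding [x] with a zero first entry transfers the operator bound from [A] to [B]; hence the
   enlarged diagonal is still nonincreasing. *)
have S'_le : forall i j, S' i j <= s.
  apply: (svd_entry_le svdB s0) => x; have [U1 _] := hU; have [V1 _] := hV.
  have := bound (V *m col_mx 0 x); rewrite defA -!mulmxA (mulmxA _ V) V1 mul1mx.
  rewrite (frob2_isol _ U1) (frob2_isol _ V1) mul_block_col.
  rewrite !mulmx0 !add0r mul0mx.
  by rewrite !frob2_col_mx !frob20 !add0r.
have [[hU' hV'] dS' S'0 S'_sorted defB] := svdB.
(* A diagonal position is the corner or a shifted diagonal position of the remaining block. *)
have diagP (i : 'I_(1 + m)) (j : 'I_(1 + n)) : i = j :> nat ->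
    (i = lshift m 0 /\ j = lshift n 0) \/
    exists a b, [/\ i = rshift 1 a, j = rshift 1 b & a = b :> nat].
  case: (split_ordP i) => a ->; case: (split_ordP j) => b -> //=;
    rewrite ?[a]ord1 ?[b]ord1 //; first by left.
  by case=> ab; right; exists a, b.
exists (U *m block_mx (1%:M : 'M_1) 0 0 U'), (block_mx (s%:M : 'M_1) 0 0 S'),
  (V *m block_mx (1%:M : 'M_1) 0 0 V').
split.
- split; first exact: (qunitaryM hU (qunitary_block (qunitary1 R 1) hU')).
  exact: (qunitaryM hV (qunitary_block (qunitary1 R 1) hV')).
- by rewrite is_diag_block_mx // !eqxx scalar_mx_is_diag.
- by move=> i j /diagP[[-> ->]|[a [b [-> -> ab]]]];
    rewrite ?block_mxEul ?block_mxEdr ?mxE //; apply: S'0.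
- move=> i i' j j' /diagP[[-> ->]|[a [b [-> -> ab]]]];
    move=> /diagP[[-> ->]|[a' [b' [-> -> ab']]]] //;
    rewrite ?block_mxEul ?block_mxEdr.
  + by rewrite mxE.
  + by rewrite leq_add2l; apply: S'_sorted.
have defD : block_mx ((realq s)%:M : 'M_1) 0 0 B =
    block_mx (1%:M : 'M_1) 0 0 U' *m qreal_mx (block_mx (s%:M : 'M_1) 0 0 S')
    *m adjq (block_mx (1%:M : 'M_1) 0 0 V').
  have qs : qreal_mx (s%:M : 'M_1) = (realq s)%:M.
    by apply/matrixP => i j; rewrite !ord1 !mxE eqxx !mulr1n.
  rewrite qreal_block_mx !qreal_mx0 adjq_block_mx !adjq0 adjq1 qs !mulmx_block.
  by rewrite !(mulmx0, mul0mx, addr0, add0r, mul1mx, mulmx1) defB.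
by rewrite defA defD adjqM !mulmxA.
Qed.

(** * Existence and uniqueness of the Moore-Penrose inverse *)

Lemma penrose_block m1 m2 n1 n2 (A : 'M[H]_(m1, n1)) (B : 'M[H]_(m2, n2)) X Y :
  penrose A X -> penrose B Y ->
  penrose (block_mx A 0 0 B) (block_mx X 0 0 Y).
Proof.
case=> x1 x2 x3 x4 [y1 y2 y3 y4]; split; rewrite !mulmx_block;
  rewrite ?adjq_block_mx !(mulmx0, mul0mx, addr0, add0r, adjq0).
- by rewrite x1 y1.
- by rewrite x2 y2.
- by rewrite x3 y3.
- by rewrite x4 y4.
Qed.

Lemma penrose_unitary m n p q (U : 'M[H]_(m, p)) (V : 'M[H]_(n, q))
    (D : 'M[H]_(p, q)) (E : 'M[H]_(q, p)) :
  qunitary U -> qunitary V -> penrose D E ->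
  penrose (U *m D *m adjq V) (V *m E *m adjq U).
Proof.
move=> [U1 _] [V1 _] [h1 h2 h3 h4].
have AX : U *m D *m adjq V *m (V *m E *m adjq U) = U *m (D *m E) *m adjq U.
  by rewrite !mulmxA -(mulmxA _ _ V) V1 mulmx1.
have XA : V *m E *m adjq U *m (U *m D *m adjq V) = V *m (E *m D) *m adjq V.
  by rewrite !mulmxA -(mulmxA _ _ U) U1 mulmx1.
split; rewrite ?AX ?XA.
- by rewrite !mulmxA -(mulmxA _ _ U) U1 mulmx1 -(mulmxA U) -(mulmxA U) h1.
- by rewrite !mulmxA -(mulmxA _ _ V) V1 mulmx1 -(mulmxA V) -(mulmxA V) h2.
- by rewrite 2!adjqM adjqK h3 mulmxA.
- by rewrite 2!adjqM adjqK h4 mulmxA.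
Qed.

(** The case [s = 0] is included: the convention [0^-1 = 0] yields exactly the Moore-Penrose inverse
    of zero. *)
Lemma penrose_real (s : R) :
  penrose ((realq s)%:M : 'M[H]_1) ((realq s^-1)%:M : 'M[H]_1).
Proof.
have adj_real (a : R) : adjq ((realq a)%:M : 'M[H]_1) = (realq a)%:M.
  by apply/matrixP => i j; rewrite adjqE !ord1 mxE eqxx mulr1n conjq_realq.
split; rewrite -!scalar_mxM -!rmorphM ?adj_real //=.
  have [->|s0] := eqVneq s 0; first by rewrite mulr0.
  by rewrite divff // mul1r.
have [->|s0] := eqVneq s 0; first by rewrite invr0 mulr0.
by rewrite mulVf // mul1r.
Qed.

Lemma penrose_exists m n (A : 'M[H]_(m, n)) : exists X, penrose A X.
Proof.
elim: m n A => [|m IH] [|n] A.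
- by exists 0; split; apply/matrixP => -[].
- exists 0; split; apply/matrixP.
  + by case.
  + by move=> i -[].
  + by case.
  + by move=> i j; rewrite mul0mx adjq0.
- exists 0; split; apply/matrixP.
  + by move=> i -[].
  + by case.
  + by move=> i j; rewrite mulmx0 adjq0.
  + by case.
rewrite -[m.+1]/(1 + m)%N -[n.+1]/(1 + n)%N in A *.
have [U [V [s [B [[hU hV] _ _ ->]]]]] := svd_step A.
have [Y hY] := IH _ B.
exists (V *m block_mx (realq s^-1)%:M 0 0 Y *m adjq U).
by apply: penrose_unitary => //; apply: penrose_block hY; apply: penrose_real.
Qed.

(** [A *m X] and [A *m Y] are self-adjoint idempotents with the same range, hence equal; likewise
    [X *m A] and [Y *m A]. Then [X = X *m A *m X] turns into [Y *m A *m Y]. *)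
Lemma penrose_unique m n (A : 'M[H]_(m, n)) X Y :
  penrose A X -> penrose A Y -> X = Y.
Proof.
case=> x1 x2 x3 x4 [y1 y2 y3 y4].
have AXY : A *m X = A *m Y.
  rewrite -x3 -{1}y1 -(mulmxA _ A) adjqM x3 y3 mulmxA -(mulmxA _ X).
  by rewrite mulmxA x1.
have XAY : X *m A = Y *m A.
  rewrite -x4 -{1}y1 !mulmxA -(mulmxA _ Y) adjqM x4 y4 -mulmxA (mulmxA A).
  by rewrite x1.
by rewrite -x2 XAY -mulmxA AXY mulmxA.
Qed.

Lemma pinvqP m n (A : 'M[H]_(m, n)) : penrose A (pinvq A).
Proof.
rewrite /pinvq; case: xgetP => [X -> //|].
by case: (penrose_exists A) => X hX /(_ X).
Qed.

Lemma pinvq_eq m n (A : 'M[H]_(m, n)) X : penrose A X -> pinvq A = X.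
Proof. exact/penrose_unique/pinvqP. Qed.

End SingularValueDecomposition.

(** * Submultiplicativity of the spectral norm against the Frobenius norm *)

Section SpectralNorm.
Variable R : realType.
Local Notation H := (quaternion R).

Lemma qsvd_frob2 m n p q (A : 'M[H]_(m, n)) (U : 'M[H]_(m, p))
    (S : 'M[R]_(p, q)) (V : 'M[H]_(n, q)) :
  is_qsvd A U S V -> frob2 A = frob2 (qreal_mx S).
Proof.
move=> [[[U1 _] [V1 _]] _ _ _ ->].
by rewrite frob2_isor ?adjqK // (frob2_isol _ U1).
Qed.

(** A supremum dominates its set only if the set is bounded; the Frobenius norm bounds the singular
    values of every decomposition at once. *)
Lemma singular_value_le_spec_norm m n (A : 'M[H]_(m, n)) (sigma : R) :
  singular_values A sigma -> sigma <= spec_norm A.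
Proof.
apply: ub_le_sup; exists (Num.sqrt (frob2 A)).
move=> _ [U [S [V [svd [i [j [ij ->]]]]]]].
have S0 : 0 <= S i j by case: svd => _ _ /(_ i j ij).
rewrite -(ler_pXn2r (n := 2)) ?nnegrE ?sqrtr_ge0 // sqr_sqrtr ?frob2_ge0 //.
rewrite (qsvd_frob2 svd); apply: le_trans (normq2_le_frob2 _ i j).
by rewrite mxE normq2_realq.
Qed.

Lemma qsvd_entry_sqr_le m n (A : 'M[H]_(m, n)) (U : 'M[H]_m) (S : 'M[R]_(m, n))
    (V : 'M[H]_n) : is_qsvd A U S V ->
  forall (i : 'I_m) (j : 'I_n), i = j :> nat -> S i j ^+ 2 <= spec_norm A ^+ 2.
Proof.
move=> svd i j ij; have S0 : 0 <= S i j by case: svd => _ _ /(_ i j ij).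
have Sle : S i j <= spec_norm A.
  by apply: singular_value_le_spec_norm; exists U, S, V; split=> //; exists i, j.
by rewrite ler_pXn2r ?nnegrE // (le_trans S0).
Qed.

(** The unitary factors of a decomposition preserve the norm, which leaves a diagonal factor with
    entries at most [spec_norm A]. *)
Lemma frob2_mul_specl m n p (A : 'M[H]_(m, n)) (N : 'M[H]_(n, p)) :
  frob2 (A *m N) <= spec_norm A ^+ 2 * frob2 N.
Proof.
have [U [S [V svd]]] := qsvd_exists A.
have Sle := qsvd_entry_sqr_le svd.
have [[[U1 _] [_ V2]] dS _ _ defA] := svd.
rewrite {1}defA -!mulmxA (frob2_isol _ U1).
apply: le_trans (frob2_diag_mul _ dS Sle (sqr_ge0 _)) _.
by rewrite frob2_isol ?adjqK.
Qed.

(** Adjoints are taken only after the decomposition is inserted: the diagonal factor moves to the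
    left as [S^T], and the constant remains the spectral norm of [A] itself. *)
Lemma frob2_mul_specr m n p (N : 'M[H]_(p, m)) (A : 'M[H]_(m, n)) :
  frob2 (N *m A) <= spec_norm A ^+ 2 * frob2 N.
Proof.
have [U [S [V svd]]] := qsvd_exists A.
have Sle := qsvd_entry_sqr_le svd.
have [[[_ U2] [V1 _]] dS _ _ defA] := svd.
rewrite {1}defA !mulmxA frob2_isor ?adjqK //.
rewrite -frob2_adj adjqM adjq_qreal.
have dST : is_diag_mx S^T.
  apply/is_diag_mxP => i j ij; rewrite mxE.
  by move/is_diag_mxP: dS; apply; rewrite eq_sym.
apply: le_trans (frob2_diag_mul _ dST _ (sqr_ge0 (spec_norm A))) _.
  by move=> i j ij; rewrite mxE; apply: Sle.
by rewrite frob2_adj frob2_isor.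
Qed.

End SpectralNorm.

(** * Pseudoinverses of matrices of full rank *)

Section PseudoInverse.
Variable R : realType.
Local Notation H := (quaternion R).

Lemma full_col_rank_cancel m n p (M : 'M[H]_(m, n)) (N P : 'M[H]_(n, p)) :
  full_col_rank M -> M *m N = M *m P -> N = P.
Proof.
move=> hM MNP; apply/matrixP => i j; apply/eqP; rewrite -subr_eq0; apply/eqP.
have /(congr1 (fun v : 'cV_n => v i 0)) : col j (N - P) = 0.
  by apply: hM; rewrite colE mulmxA mulmxBr MNP subrr mul0mx.
by rewrite !mxE.
Qed.

(** [M] cancels on the left in the first Penrose equation. *)
Lemma pinvq_mull m n (M : 'M[H]_(m, n)) :
  full_col_rank M -> pinvq M *m M = 1%:M.
Proof.
move=> hM; apply: (full_col_rank_cancel hM).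
by rewrite mulmx1 mulmxA; case: (pinvqP M).
Qed.

(** The adjoint of the first Penrose equation has [adjq M] on the left, where it cancels;
    [M *m pinvq M] is its own adjoint. *)
Lemma pinvq_mulr m n (M : 'M[H]_(m, n)) :
  full_col_rank (adjq M) -> M *m pinvq M = 1%:M.
Proof.
move=> hM; have [h1 _ h3 _] := pinvqP M.
rewrite -h3 -[RHS]adjq1; congr adjq; rewrite -h3.
apply: (full_col_rank_cancel hM); rewrite -adjqM h1.
by rewrite mulmx1.
Qed.

(** The reverse order law fails for general [M]. Full column rank makes [C *m pinvq M] a left
    inverse of [M *m B], so that the fourth Penrose equation concerns the identity. *)
Lemma pinvq_mul_inv m n (M : 'M[H]_(m, n)) (B C : 'M[H]_n) :
  full_col_rank M -> B *m C = 1%:M -> C *m B = 1%:M ->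
  pinvq (M *m B) = C *m pinvq M.
Proof.
move=> hM BC CB; have [h1 h2 h3 _] := pinvqP M; have h4 := pinvq_mull hM.
have MB : M *m B *m (C *m pinvq M) = M *m pinvq M.
  by rewrite !mulmxA -(mulmxA M) BC mulmx1.
have CM : C *m pinvq M *m (M *m B) = 1%:M.
  by rewrite mulmxA -(mulmxA C) h4 mulmx1.
apply: pinvq_eq; split; rewrite ?MB ?CM ?mul1mx ?adjq1 //.
by rewrite mulmxA h1.
Qed.

End PseudoInverse.

(** * Error of projecting onto the range of a sketch *)

Section ProjectionError.
Variable R : realType.
Local Notation H := (quaternion R).

(** Pythagoras for [M] split into its projection and the residual. *)
Lemma frob2_proj_le m s n (Q : 'M[H]_(m, s)) (M : 'M[H]_(m, n)) :
  orthonormal_cols Q -> frob2 (M - Q *m adjq Q *m M) <= frob2 M.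
Proof.
move=> hQ; rewrite -[X in _ <= frob2 X](subrK (Q *m adjq Q *m M)).
rewrite [leRHS]frob2_pythagoras ?lerDl ?frob2_ge0 //.
rewrite adjqD adjqN !adjqM adjqK mulmxBl !mulmxA.
by rewrite -(mulmxA _ (adjq Q) Q) hQ mulmx1 subrr.
Qed.

(** Each column of [N] is a combination of columns of [M]; choice collects the coefficient vectors
    into [Z]. *)
Lemma qrange_colsub m n p (M : 'M[H]_(m, n)) (N : 'M[H]_(m, p)) :
  (qrange N `<=` qrange M)%classic -> exists Z, N = M *m Z.
Proof.
move=> NM.
have /(_ _)/cid-/all_sig[z hz] (j : 'I_p) :
    exists z : 'cV[H]_n, M *m z = col j N.
  have [|z _ <-] := NM (col j N); last by exists z.
  by exists (delta_mx j 0) => //; rewrite colE.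
exists (\matrix_(i, j) z j i 0); apply/matrixP => i j.
have /(congr1 (fun v : 'cV_m => v i 0)) := hz j; rewrite [RHS]mxE => <-.
by rewrite !mxE; apply: eq_bigr => k _; rewrite mxE.
Qed.

Lemma range_finder_error m n r s k (A : 'M[H]_(m, n)) (Omega : 'M[H]_(n, s))
    (Q : 'M[H]_(m, k)) (p q : nat)
    (U1 : 'M[H]_(m, r)) (U2 : 'M[H]_(m, p))
    (Sigma1 : 'M[R]_r) (Sigma2 : 'M[R]_(p, q))
    (V1 : 'M[H]_(n, r)) (V2 : 'M[H]_(n, q)) :
  orthonormal_cols Q ->
  Q *m adjq Q *m (A *m Omega) = A *m Omega ->
  is_qsvd A (row_mx U1 U2) (block_mx Sigma1 0 0 Sigma2) (row_mx V1 V2) ->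
  full_col_rank (adjq (adjq V1 *m Omega)) ->
  frob2 (A - Q *m adjq Q *m A) <=
  (1 + spec_norm (adjq V2 *m Omega *m pinvq (adjq V1 *m Omega)) ^+ 2)
  * frob2 (qreal_mx Sigma2).
Proof.
move=> hQ QY [[hU hV] _ _ _ defA] /pinvq_mulr.
set X := pinvq _ => O1X; set F := _ *m X.
set V := row_mx V1 V2 in hV defA; set U := row_mx U1 U2 in hU defA.
have [VV VV'] := hV; have [UU _] := hU.
(* An oblique projector, by [O1X]. The columns of [A *m T] lie in the range of [A *m Omega], which
   [Q *m adjq Q] fixes, so subtracting [A *m T] from [A] leaves the residual unchanged. *)
pose T := Omega *m X *m adjq V1.
have -> : A - Q *m adjq Q *m A =
    A *m (1%:M - T) - Q *m adjq Q *m (A *m (1%:M - T)).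
  have AT : Q *m adjq Q *m (A *m T) = A *m T.
    by rewrite /T !mulmxA -(mulmxA _ A) QY.
  rewrite [A *m _]mulmxBr mulmx1 [in RHS]mulmxBr AT opprB.
  by rewrite addrA subrK.
apply: le_trans (frob2_proj_le _ hQ) _.
have V1V : adjq V1 *m V = row_mx 1%:M 0.
  move: VV; rewrite adjq_row_mx mul_col_mx mul_mx_row scalar_mx_block.
  by case/eq_col_mx.
have VX : adjq V *m (Omega *m X) = col_mx 1%:M F.
  by rewrite adjq_row_mx mul_col_mx !mulmxA O1X.
(* In the basis [V], the projector [T] has block rows [[1, 0]] and [[F, 0]]. Thus [1%:M - T] has a
   zero first block row, which eliminates [Sigma1] and leaves the block row
   [[- Sigma2 F, Sigma2]]. *)
have -> : 1%:M - T = V *m block_mx 0 0 (- F) 1%:M *m adjq V.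
  have <- : adjq V *m (1%:M - T) *m V = block_mx 0 0 (- F) 1%:M.
    rewrite -mulmxA mulmxBl mul1mx mulmxBr VV /T -[_ *m V]mulmxA V1V mulmxA VX.
    rewrite mul_col_row !mulmx1 !mulmx0 scalar_mx_block opp_block_mx.
    by rewrite add_block_mx subrr !oppr0 !addr0 add0r.
  by rewrite !mulmxA VV' mul1mx -mulmxA VV' mulmx1.
rewrite defA !mulmxA frob2_isor ?adjqK // -!mulmxA (frob2_isol _ UU).
rewrite (mulmxA _ V) VV mul1mx qreal_block_mx !qreal_mx0.
rewrite mulmx_block !(mul0mx, mulmx0, addr0, add0r) mulmx1 mulmxN.
rewrite frob2_col_mx !frob2_row_mx !frob20 !add0r frob2N.
rewrite addrC mulrDl mul1r lerD2l.
exact: frob2_mul_specr.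
Qed.

End ProjectionError.

(** * Orthogonal splitting of the sketching error and its bound *)

Theorem theorem4p1 (R : realType) (m n r s l : nat)
  (hrs : (r <= s)%N) (hsl : (s <= l)%N) (hlmn : (l <= minn m n)%N)
  (A : 'M[quaternion R]_(m, n))
  (Omega : 'M[quaternion R]_(n, s)) (Psi : 'M[quaternion R]_(l, m))
  (H : 'M[quaternion R]_(m, s))
  (Q : 'M[quaternion R]_(m, s)) (B : 'M[quaternion R]_s)
  (Qp : 'M[quaternion R]_(m, m - s))
  (U1 : 'M[quaternion R]_(m, r)) (U2 : 'M[quaternion R]_(m, m - r))
  (Sigma1 : 'M[R]_r) (Sigma2 : 'M[R]_(m - r, n - r))
  (V1 : 'M[quaternion R]_(n, r)) (V2 : 'M[quaternion R]_(n, n - r)) :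
  let Y := A *m Omega in
  let W := Psi *m A in
  let X := pinvq (Psi *m H) *m W in
  let Psi1 := Psi *m Qp in
  let Psi2 := Psi *m Q in
  let Omega1 := adjq V1 *m Omega in
  let Omega2 := adjq V2 *m Omega in
  qrange H = qrange Y ->
  full_col_rank H ->
  H = Q *m B ->
  orthonormal_cols Q ->
  qinvertible B ->
  orthonormal_cols Qp ->
  Qp *m adjq Qp = 1%:M - Q *m adjq Q ->
  is_qsvd A (row_mx U1 U2) (block_mx Sigma1 0 0 Sigma2) (row_mx V1 V2) ->
  full_col_rank (adjq Omega1) ->
  full_col_rank Psi2 ->
  frob_norm (A - H *m X) ^+ 2 =
    frob_norm (A - Q *m adjq Q *m A) ^+ 2
    + frob_norm (pinvq Psi2 *m Psi1 *m (adjq Qp *m A)) ^+ 2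
  /\
  frob_norm (A - Q *m adjq Q *m A) ^+ 2
    + frob_norm (pinvq Psi2 *m Psi1 *m (adjq Qp *m A)) ^+ 2
  <= (1 + spec_norm (pinvq Psi2 *m Psi1) ^+ 2)
     * (1 + spec_norm (Omega2 *m pinvq Omega1) ^+ 2)
     * frob_norm (qreal_mx Sigma2) ^+ 2.
Proof.
move=> Y W X Psi1 Psi2 Omega1 Omega2 rHY _ defH hQ.
move=> [C [BC CB]] hQp QpQp svd hO hP.
have [Z defY] : exists Z, Y = H *m Z by apply: qrange_colsub; rewrite rHY.
have QY : Q *m adjq Q *m (A *m Omega) = A *m Omega.
  by rewrite -/Y defY defH !mulmxA -(mulmxA Q _ Q) hQ mulmx1.
set E := pinvq Psi2 *m Psi1.
pose P := A - Q *m adjq Q *m A.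
have defP : P = Qp *m (adjq Qp *m A).
  by rewrite mulmxA QpQp mulmxBl mul1mx.
(* The pseudoinverse of [Psi *m H = Psi2 *m B] is [C *m pinvq Psi2], so [B] cancels in [H *m X].
   Splitting [Psi] along [Q] and [Qp] then gives the two terms, the first because [pinvq Psi2] is a
   left inverse of [Psi2]. *)
have defX : H *m X = Q *m adjq Q *m A + Q *m (E *m (adjq Qp *m A)).
  have defPsi : Psi = Psi2 *m adjq Q + Psi1 *m adjq Qp.
    by rewrite -!mulmxA -mulmxDr QpQp addrC subrK mulmx1.
  have PsiA : pinvq Psi2 *m W = adjq Q *m A + E *m (adjq Qp *m A).
    rewrite /W {1}defPsi mulmxDl mulmxDr; congr (_ + _).
      by rewrite -(mulmxA Psi2) mulmxA (pinvq_mull hP) mul1mx.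
    by rewrite /E !mulmxA.
  rewrite /X defH (mulmxA Psi) -/Psi2 (pinvq_mul_inv hP BC CB) -(mulmxA C).
  by rewrite PsiA mulmxA -(mulmxA Q) BC mulmx1 mulmxDr (mulmxA Q).
(* The columns of [P] are orthogonal to the range of [Q], which contains the other error term. *)
have errE : frob2 (A - H *m X) = frob2 P + frob2 (E *m (adjq Qp *m A)).
  have PQ : adjq P *m Q = 0.
    by rewrite adjqD adjqN !adjqM adjqK mulmxBl -!mulmxA hQ mulmx1 subrr.
  rewrite defX opprD addrA -/P (frob2_pythagoras (M := P)).
    by rewrite frob2N (frob2_isol _ hQ).
  by rewrite mulmxN (mulmxA (adjq P)) PQ mul0mx oppr0.
have QpA : frob2 (adjq Qp *m A) = frob2 P by rewrite defP (frob2_isol _ hQp).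
rewrite !frob_norm_sqr; split; first exact: errE.
have h1 := frob2_mul_specl E (adjq Qp *m A); rewrite QpA in h1.
have h2 := range_finder_error hQ QY svd hO.
(* Both error terms are controlled by [P], since [adjq Qp *m A] has the same norm as [P]; this
   produces the factor [1 + spec_norm E ^+ 2]. *)
rewrite -/P -mulrA; apply: (@le_trans _ _ ((1 + spec_norm E ^+ 2) * frob2 P)).
  by rewrite mulrDl mul1r lerD2l.
by apply: ler_wpM2l h2; rewrite addr_ge0 ?sqr_ge0.
Qed.
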